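(* Let $A$ be a simple abelian variety of dimension $g$ over $\mathbf{F}_q$ with associated Weil number $\pi$. Let $n=[\mathbf{Q}(\pi):\mathbf{Q}]$ and let $\Delta$ be the discriminant of the number field $\mathbf{Q}(\pi)$. Then the root discriminant $\mathrm{rd} := |\Delta|^{1/n}$ of $\mathbf{Q}(\pi)$ satisfies \[\mathrm{rd} \le 2g\,q^{g/2}.\]
   Context: For a simple abelian variety $A$ over $\mathbf{F}_q$, the Weil polynomial $\det(T-F\mid H^1(A))$ ($F$ the $q$-Frobenius) equals $h_A(T)^e$ for an irreducible $h_A\in\mathbf{Z}[T]$ and some $e\ge1$; the associated Weil number $\pi$ is a root of $h_A$, and $\mathbf{Q}(\pi)\cong\mathbf{Q}[T]/(h_A)$. *)

(* Defs.v *)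
From HB Require Import structures.
From mathcomp Require Export all_boot all_order all_algebra all_field.
From mathcomp Require Export mpoly.

Set Implicit Arguments.
Unset Strict Implicit.
Unset Printing Implicit Defensive.

Import Order.TTheory GRing.Theory Num.Theory.
Local Open Scope ring_scope.

Section ProjectiveSpace.

Variable K : fieldType.

(* A point of P^N(K) is a line in K^(N+1). *)
Record proj_point (N : nat) := ProjPoint {
  pline : {vspace 'rV[K]_N.+1};
  pline_dim : \dim pline == 1%N
}.

Definition hcoords N (p : proj_point N) (v : 'rV[K]_N.+1) : bool :=
  (v != 0) && (v \in pline p).

Definition peval (F : fieldType) (iota : {rmorphism F -> K}) (n : nat)
    (f : {mpoly F[n]}) (v : 'rV[K]_n) : K :=
  (map_mpoly iota f).@[fun i => v ord0 i].

Definition zero_locus (F : fieldType) (iota : {rmorphism F -> K}) (N : nat)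
    (S : seq {mpoly F[N.+1]}) (p : proj_point N) : Prop :=
  forall f v, f \in S -> hcoords p v -> peval iota f v = 0.

(* Zariski closed subsets of P^N(K) cut out by equations over the subfield F. *)
Definition closed_over (F : fieldType) (iota : {rmorphism F -> K}) (N : nat)
    (Z : proj_point N -> Prop) : Prop :=
  exists S : seq {mpoly F[N.+1]},
    (forall f, f \in S -> exists d : nat, f \is d.-homog) /\
    (forall p, Z p <-> zero_locus iota S p).

Definition zclosed (N : nat) (Z : proj_point N -> Prop) : Prop :=
  closed_over (idfun : {rmorphism K -> K}) Z.

Definition subset_pts (N : nat) (Y Z : proj_point N -> Prop) : Prop :=
  forall p, Y p -> Z p.

Definition zirreducible (N : nat) (Z : proj_point N -> Prop) : Prop :=
  (exists p, Z p) /\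
  forall Z1 Z2 : proj_point N -> Prop, zclosed Z1 -> zclosed Z2 ->
    subset_pts Z (fun p => Z1 p \/ Z2 p) -> subset_pts Z Z1 \/ subset_pts Z Z2.

Definition has_chain (N : nat) (X : proj_point N -> Prop) (d : nat) : Prop :=
  exists C : nat -> proj_point N -> Prop,
    (forall i, (i <= d)%N ->
       [/\ zclosed (C i), zirreducible (C i) & subset_pts (C i) X]) /\
    (forall i, (i < d)%N ->
       subset_pts (C i) (C i.+1) /\ ~ subset_pts (C i.+1) (C i)).

(* Krull dimension. *)
Definition zdim (N : nat) (X : proj_point N -> Prop) (d : nat) : Prop :=
  has_chain X d /\ ~ has_chain X d.+1.

End ProjectiveSpace.

Section Morphisms.

Variables (F K : fieldType) (iota : {rmorphism F -> K}).

(* phi restricts to a morphism of F-varieties on X: near each point of X it is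
   given by forms of one degree with coefficients in F.  The values of phi off X
   are irrelevant. *)
Definition regular_on (N M : nat) (X : proj_point K N -> Prop)
    (phi : proj_point K N -> proj_point K M) : Prop :=
  forall p, X p ->
  exists (d : nat) (f : 'I_M.+1 -> {mpoly F[N.+1]}),
    let fv (v : 'rV[K]_N.+1) : 'rV[K]_M.+1 := \row_i peval iota (f i) v in
    [/\ forall i, f i \is d.-homog,
        exists2 v, hcoords p v & fv v != 0
      & forall p' v, X p' -> hcoords p' v -> fv v != 0 ->
          hcoords (phi p') (fv v)].

Definition bihomog (m n : nat) (d1 d2 : nat) (f : {mpoly F[m + n]}) : Prop :=
  forall u : 'X_{1..(m + n)}, u \in msupp f ->
    (\sum_(i < m) u (lshift n i) = d1)%N /\ (\sum_(i < n) u (rshift m i) = d2)%N.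

Definition regular2_on (N M : nat) (X : proj_point K N -> Prop)
    (phi : proj_point K N -> proj_point K N -> proj_point K M) : Prop :=
  forall p1 p2, X p1 -> X p2 ->
  exists (d1 d2 : nat) (f : 'I_M.+1 -> {mpoly F[N.+1 + N.+1]}),
    let fv (v w : 'rV[K]_N.+1) : 'rV[K]_M.+1 :=
      \row_i peval iota (f i) (row_mx v w) in
    [/\ forall i, bihomog d1 d2 (f i),
        exists v w, [/\ hcoords p1 v, hcoords p2 w & fv v w != 0]
      & forall p1' p2' v w, X p1' -> X p2' -> hcoords p1' v -> hcoords p2' w ->
          fv v w != 0 -> hcoords (phi p1' p2') (fv v w)].

Definition algebraic_closure : Prop := forall x : K, algebraicOver iota x.

End Morphisms.

(* An abelian variety over the finite field F: a geometrically irreducible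
   projective variety with a group law defined over F, described through its
   points over the algebraic closure K of F.  Since F is perfect, reduced
   subschemes of P^N over F correspond to the sets [closed_over iota], and group
   varieties are automatically smooth; commutativity of the law is a theorem. *)
Record abelian_variety (F : finFieldType) (K : closedFieldType)
    (iota : {rmorphism F -> K}) := AbelianVariety {
  av_N : nat;
  av_pts : proj_point K av_N -> Prop;
  av_zero : proj_point K av_N;
  av_opp : proj_point K av_N -> proj_point K av_N;
  av_add : proj_point K av_N -> proj_point K av_N -> proj_point K av_N;
  av_closed : closed_over iota av_pts;
  av_irreducible : zirreducible av_pts;
  av_zeroP : av_pts av_zero;
  av_oppP : forall x, av_pts x -> av_pts (av_opp x);
  av_addP : forall x y, av_pts x -> av_pts y -> av_pts (av_add x y);
  av_zero_rational : exists v : 'rV[F]_av_N.+1,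
    hcoords av_zero (map_mx iota v);
  av_opp_regular : regular_on iota av_pts av_opp;
  av_add_regular : regular2_on iota av_pts av_add;
  av_addA : forall x y z, av_pts x -> av_pts y -> av_pts z ->
    av_add x (av_add y z) = av_add (av_add x y) z;
  av_add0 : forall x, av_pts x -> av_add av_zero x = x /\ av_add x av_zero = x;
  av_addN : forall x, av_pts x ->
    av_add (av_opp x) x = av_zero /\ av_add x (av_opp x) = av_zero
}.

Section AbelianVarieties.

Variables (F : finFieldType) (K : closedFieldType) (iota : {rmorphism F -> K}).
Variable A : abelian_variety iota.

Notation point := (proj_point K (av_N A)).

Definition av_dim (g : nat) : Prop := zdim (av_pts (a := A)) g.

Definition abelian_subvariety (B : point -> Prop) : Prop :=
  [/\ closed_over iota B, zirreducible B & subset_pts B (av_pts (a := A))] /\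
  [/\ B (av_zero A),
      forall x, B x -> B (av_opp x)
    & forall x y, B x -> B y -> B (av_add x y)].

Definition av_simple : Prop :=
  (exists2 x, av_pts (a := A) x & x <> av_zero A) /\
  forall B, abelian_subvariety B ->
    (forall x, B x -> x = av_zero A) \/ subset_pts (av_pts (a := A)) B.

Definition av_muln (n : nat) (x : point) : point :=
  iter n (av_add x) (av_zero A).

Definition av_mulz (c : int) (x : point) : point :=
  match c with
  | Posz n => av_muln n x
  | Negz n => av_opp (av_muln n.+1 x)
  end.

(* y is the image of x under the q-Frobenius, q = #|F|. *)
Definition frobenius_image (x y : point) : Prop :=
  forall v, hcoords x v -> hcoords y (map_mx (fun t => t ^+ #|F|) v).

(* An l-adic integer, given by representatives c k of its residues mod l^k. *)
Definition padic_seq (l : nat) (c : nat -> int) : Prop :=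
  forall k : nat, (c k.+1 = c k %[mod (l ^ k)%:Z])%Z.

(* The elements of the Tate module T_l A = lim A[l^k](K). *)
Definition tate_elt (l : nat) (x : nat -> point) : Prop :=
  [/\ forall k, av_pts (x k), x 0%N = av_zero A
    & forall k, av_muln l (x k.+1) = x k].

(* The level-k component of a combination of elements of T_l A. *)
Definition tate_comb (r : nat) (c : 'I_r -> int) (e : 'I_r -> nat -> point)
    (k : nat) : point :=
  \big[@av_add _ _ _ A/av_zero A]_(i < r) av_mulz (c i) (e i k).

(* e is a basis of T_l A as a module over the l-adic integers. *)
Definition tate_basis (l r : nat) (e : 'I_r -> nat -> point) : Prop :=
  [/\ forall i, tate_elt l (e i),
      forall x, tate_elt l x -> exists c : 'I_r -> nat -> int,
        (forall i, padic_seq l (c i)) /\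
        (forall k, x k = tate_comb (fun i => c i k) e k)
    & forall c : 'I_r -> nat -> int, (forall i, padic_seq l (c i)) ->
        (forall k, tate_comb (fun i => c i k) e k = av_zero A) ->
        forall i k, ((l ^ k)%:Z %| c i k)%Z].

(* P = det(T - F | T_l A), with T_l A free of rank r; M k represents mod l^k the
   matrix of F.  For l prime to q, H^1(A) is the l-adic cohomology
   Hom(T_l A, Q_l), on which F acts by the transpose, and r = 2 dim A. *)
Definition frobenius_charpoly (l r : nat) (P : {poly int}) : Prop :=
  exists (e : 'I_r -> nat -> point) (M : nat -> 'M[int]_r),
    [/\ tate_basis l e,
        forall i j, padic_seq l (fun k => M k i j),
        forall i k, frobenius_image (e i k) (tate_comb (M k i) e k)
      & forall k j : nat,
          ((char_poly (M k))`_j = P`_j %[mod (l ^ k)%:Z])%Z].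

End AbelianVarieties.

Definition irreducible_elt (R : idomainType) (x : R) : Prop :=
  [/\ x != 0, x \isn't a GRing.unit
    & forall a b : R, x = a * b ->
        a \is a GRing.unit \/ b \is a GRing.unit].

Section NumberFields.

Variable L : fieldExtType rat.

Definition alg_integer (x : L) : Prop := integralOver (intr : int -> L) x.

Definition weil_number (q : nat) (x : L) : Prop :=
  alg_integer x /\
  forall sigma : {rmorphism L -> algC}, `|sigma x| = sqrtC q%:R.

Definition field_trace (x : L) : rat :=
  \tr (\matrix_(i, j) coord (vbasis {:L}) j (x * tnth (vbasis {:L}) i)).

Definition integral_basis (b : (\dim {:L}).-tuple L) : Prop :=
  basis_of fullv b /\
  forall x : L, alg_integer x <->
    exists c : 'I_(\dim {:L}) -> int, x = \sum_i (c i)%:~R * tnth b i.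

Definition field_discriminant (Delta : int) : Prop :=
  exists2 b : (\dim {:L}).-tuple L, integral_basis b &
    Delta%:~R = \det (\matrix_(i, j) field_trace (tnth b i * tnth b j)).

End NumberFields.

(* Main.v *)
From HB Require Import structures.
Require Import Defs.
From mathcomp Require Import zify.
Set Implicit Arguments.
Unset Strict Implicit.
Unset Printing Implicit Defensive.
Import Order.TTheory GRing.Theory Num.Theory.
Local Open Scope ring_scope.

(* The Weil polynomial has degree 2g, so n = [Q(pi) : Q] <= 2g.  Since all the
   conjugates of pi have absolute value sqrt q, the element q / pi is the complex
   conjugate of pi under every embedding, hence an algebraic integer.  Writing
   m = floor(n / 2), the n elements (q / pi)^m, ..., q / pi, 1, pi, ...,
   pi^(n - m - 1) are therefore integral, and they are independent over Q, so
   |Delta| is at most the square of the determinant of the matrix of their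
   conjugates.  Hadamard's inequality bounds this by n^n q^D, where
   D = sum_(i < n) |i - m| <= n^2 / 4; hence
   rd <= n q^(n / 4) <= 2g q^(g / 2).
   The plain power basis would only give the exponent (n - 1) / 2 of q. *)

(** * Hadamard's inequality, through Gram-Schmidt orthonormalization *)

Local Open Scope sesquilinear_scope.

(** Row [i] of [A] lies in the span of the rows of [schmidt A] of index at most [i], and these are
    orthogonal to every later row [j]. *)
Lemma mulmx_schmidt_trig (C : numClosedFieldType) n (A : 'M[C]_n) :
  is_trig_mx (A *m (schmidt A)^t*).
Proof.
pose U : 'M[C]_n := schmidt A; rewrite -/U.
have /row_unitarymxP Uo : U \is unitarymx by exact: schmidt_unitarymx.
apply/is_trig_mxP => i j lt_ij.
have -> : (A *m U^t*) i j = dotmx (row i A) (row j U).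
  by rewrite dotmxE !mxE; apply: eq_bigr => k _; rewrite !mxE.
have /sub_kermxP rA0 : (row i A <= kermx ((row j U)^t*))%MS.
  apply: submx_trans (row_schmidt_sub A i) _; apply/sumsmx_subP => k le_ki.
  rewrite genmxE; apply/sub_kermxP/matrixP => a b; rewrite !ord1 -dotmxE Uo mxE.
  by case: eqP => // ekj; move: lt_ij; rewrite -ekj ltnNge le_ki.
by rewrite dotmxE rA0 mxE.
Qed.

(** Multiplying by the adjoint of the unitary [U] keeps the modulus of the determinant and makes [A]
    triangular. Each diagonal entry pairs a row of [A] with a unit vector, so Cauchy-Schwarz bounds
    it by the norm of that row. *)
Lemma hadamard_det (C : numClosedFieldType) n (A : 'M[C]_n) :
  `|\det A| ^+ 2 <= \prod_i \sum_j `|A i j| ^+ 2.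
Proof.
pose U : 'M[C]_n := schmidt A.
have Uu : U \is unitarymx by exact: schmidt_unitarymx.
have detU : `|\det (U^t*)| ^+ 2 = 1.
  have := congr1 determinant (unitarymxP Uu).
  by rewrite det_mulmx det1 det_map_mx det_tr normCK conjCK mulrC.
rewrite -[leLHS]mulr1 -[X in _ * X]detU -exprMn -normrM -det_mulmx.
rewrite (det_trig (mulmx_schmidt_trig A)) normr_prod -prodrXl.
apply: ler_prod => i _; rewrite exprn_ge0 ?normr_ge0 //=.
have -> : (A *m U^t*) i i = dotmx (row i A) (row i U).
  by rewrite dotmxE !mxE; apply: eq_bigr => k _; rewrite !mxE.
apply: le_trans (CauchySchwarz (@dotmx C n) (row i A) (row i U)) _.
rewrite [X in _ * X](row_unitarymxP Uu) eqxx mulr1 [leLHS]dotmxE mxE le_eqVlt; apply/orP; left.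
by apply/eqP/eq_bigr => k _; rewrite !mxE normCK.
Qed.

(** At [k = |a|] the divisor [l ^ k] already exceeds [|a|]. This turns congruences modulo all
    [l ^ k] into equalities of integers. *)
Lemma dvd_all_powers_eq0 (l : nat) (a : int) :
  (1 < l)%N -> (forall k, ((l ^ k)%:Z %| a)%Z) -> a = 0.
Proof.
move=> l_gt1 /(_ `|a|%N); rewrite dvdzE absz_nat => /dvdn_leq le_a.
apply/eqP; rewrite -absz_eq0 -leqn0 leqNgt; apply/negP => /le_a.
by rewrite leqNgt ltn_expl.
Qed.

(** * Complex embeddings of a number field, the trace form and the discriminant *)

Section Embeddings.

Variables (L : fieldExtType rat) (x : L).
Hypothesis genL : <<1; x>>%VS = fullv.

Local Notation n := (\dim {:L}).
Local Notation evL p := (map_poly (in_alg L) p).[x].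
Local Notation evC p z := (map_poly (ratr : rat -> algC) p).[z].

Lemma ex_evL (y : L) : exists q : {poly rat}, evL q == y.
Proof.
have /Fadjoin_polyP[p /polyOver1P[q ->] ->] : y \in <<1%AS; x>>%VS.
  by rewrite genL memvf.
by exists q.
Qed.

Lemma ex_rat_minPoly : exists p : {poly rat}, map_poly (in_alg L) p = minPoly 1 x.
Proof. by have /polyOver1P[p ->] := minPolyOver 1%AS x; exists p. Qed.

Lemma evC_root (p q : {poly rat}) z : map_poly (in_alg L) p = minPoly 1 x ->
  evC p z = 0 -> evL q = 0 -> evC q z = 0.
Proof.
move=> Dp pz0 qx0; have : map_poly (in_alg L) p %| map_poly (in_alg L) q.
  rewrite Dp; apply: (@minPoly_dvdp _ _ 1%AS); last exact/rootP.
  by apply/polyOver1P; exists q.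
by rewrite dvdp_map => /dvdpP[r ->]; rewrite rmorphM hornerM pz0 mulr0.
Qed.

(** An element of [L] is written as [evL q] for a chosen [q] and sent to [evC q z]. Two choices of
    [q] differ by a multiple of the minimal polynomial, which vanishes at [z], so the value depends
    on the element alone. *)
Lemma embedding_of_root (p : {poly rat}) z :
  map_poly (in_alg L) p = minPoly 1 x -> evC p z = 0 ->
  {sigma : {rmorphism L -> algC} | sigma x = z}.
Proof.
move=> Dp pz0; pose s y := evC (xchoose (ex_evL y)) z.
have sE q : s (evL q) = evC q z.
  apply/eqP; rewrite -subr_eq0 -hornerN -hornerD -rmorphB /=; apply/eqP.
  apply: (evC_root Dp pz0); rewrite rmorphB hornerD hornerN /=.
  by rewrite (eqP (xchooseP (ex_evL (evL q)))) subrr.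
have sB : zmod_morphism s.
  move=> y1 y2; have [[q1 /eqP<-] [q2 /eqP<-]] := (ex_evL y1, ex_evL y2).
  by rewrite -hornerN -hornerD -rmorphB !sE rmorphB hornerD hornerN.
have sM : monoid_morphism s.
  split=> [|y1 y2].
    by have := sE 1%:P; rewrite !map_polyC !hornerC /= scale1r rmorph1.
  have [[q1 /eqP<-] [q2 /eqP<-]] := (ex_evL y1, ex_evL y2).
  by rewrite -hornerM -rmorphM !sE rmorphM hornerM.
pose sRM : {rmorphism L -> algC} := HB.pack s
  (GRing.isZmodMorphism.Build _ _ s sB) (GRing.isMonoidMorphism.Build _ _ s sM).
exists sRM => /=; rewrite -[in LHS](hornerX x) -(map_polyX (in_alg L)) sE.
by rewrite map_polyX hornerX.
Qed.

(** In characteristic 0 the minimal polynomial of [x] is separable, so it has [n] distinct roots in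
    [algC], each giving an embedding. *)
Lemma embeddings_exist :
  exists s : 'I_n -> {rmorphism L -> algC}, injective (fun k => s k x).
Proof.
have [p Dp] := ex_rat_minPoly.
have szp : size p = n.+1.
  rewrite -(size_map_poly (in_alg L)) Dp size_minPoly -genL.
  by rewrite (@dim_Fadjoin _ _ 1%AS) dimv1 muln1.
have sep_p : separable_poly p.
  rewrite -(separable_map (in_alg L)) Dp.
  apply: (@pcharf0_separable _ _ 1%AS) => i; rewrite pchar_lalg.
  exact: pchar_num.
have [r Dr] := closed_field_poly_normal (map_poly (ratr : rat -> algC) p).
have lcp : lead_coef (map_poly (ratr : rat -> algC) p) != 0.
  by rewrite lead_coef_eq0 map_poly_eq0 -size_poly_eq0 szp.
have szr : size r = n.
  have := size_map_poly (ratr : {rmorphism rat -> algC}) p.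
  by rewrite /= Dr size_scale // size_prod_XsubC szp => -[].
have Ur : uniq r.
  rewrite -separable_prod_XsubC -(eqp_separable (eqp_scale _ lcp)) -Dr.
  by rewrite separable_map.
have r0 (k : 'I_n) : evC p r`_k = 0.
  by apply/rootP; rewrite Dr rootZ // root_prod_XsubC mem_nth // szr.
exists (fun k => sval (embedding_of_root Dp (r0 k))) => j k /=.
case: embedding_of_root => sj /= ->; case: embedding_of_root => sk /= ->.
by move/eqP; rewrite nth_uniq ?szr // => /eqP/val_inj.
Qed.

Lemma embedding_scale (sigma : {rmorphism L -> algC}) c y :
  sigma (c *: y) = ratr c * sigma y.
Proof.
rewrite -mulr_algl rmorphM; congr (_ * _).
exact: (fmorph_eq_rat (sigma \o in_alg L) c).
Qed.

Variable s : 'I_n -> {rmorphism L -> algC}.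
Hypothesis s_inj : injective (fun k => s k x).

Definition embed_mx (a : 'I_n -> L) : 'M[algC]_n := \matrix_(i, k) s k (a i).

Lemma det_embed_powers_neq0 : \det (embed_mx (fun i => x ^+ i)) != 0.
Proof.
have -> : embed_mx (fun i => x ^+ i) = Vandermonde n (\row_k s k x).
  by apply/matrixP => i k; rewrite !mxE rmorphXn.
rewrite det_Vandermonde; apply/prodf_neq0 => i _; apply/prodf_neq0 => j lt_ij.
rewrite !mxE subr_eq0; apply/eqP => /s_inj eji.
by rewrite eji ltnn in lt_ij.
Qed.

(** The invertible Vandermonde matrix of the powers of [x] factors through this one by expanding the
    powers in [vbasis]. *)
Lemma embed_mx_unit : embed_mx (tnth (vbasis {:L})) \in unitmx.
Proof.
rewrite unitmxE unitfE; apply: contraNneq det_embed_powers_neq0 => det0.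
have -> : embed_mx (fun i => x ^+ i) =
  (\matrix_(i, j) ratr (coord (vbasis {:L}) j (x ^+ i))) *m
  embed_mx (tnth (vbasis {:L})).
  apply/matrixP => i k; rewrite !mxE.
  rewrite [in LHS](coord_vbasis (memvf (x ^+ i))) rmorph_sum.
  by apply: eq_bigr => j _; rewrite !mxE embedding_scale (tnth_nth 0).
by rewrite det_mulmx det0 mulr0.
Qed.

(** The matrix [S] of conjugates of the basis diagonalizes multiplication by [y], with eigenvalues
    [s k y]. *)
Lemma ratr_field_trace y : ratr (field_trace y) = \sum_k s k y.
Proof.
set S := embed_mx (tnth (vbasis {:L})).
pose N := \matrix_(i, j) coord (vbasis {:L}) j (y * tnth (vbasis {:L}) i).
have NS : map_mx (ratr : rat -> algC) N *m S = S *m diag_mx (\row_k s k y).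
  apply/matrixP => i k; rewrite mul_mx_diag !mxE [RHS]mulrC -rmorphM.
  rewrite [in RHS](coord_vbasis (memvf (y * _))) rmorph_sum.
  by apply: eq_bigr => j _; rewrite !mxE embedding_scale -tnth_nth.
have -> : ratr (field_trace y) = \tr (map_mx (ratr : rat -> algC) N).
  by rewrite trace_map_mx.
rewrite -[map_mx _ _](mulmxK embed_mx_unit) NS mxtrace_mulC.
rewrite mulKmx ?embed_mx_unit //.
by rewrite mxtrace_diag; apply: eq_bigr => k _; rewrite mxE.
Qed.

(** The Gram matrix of the trace form is [embed_mx a] times its plain transpose, without
    conjugation. *)
Lemma ratr_det_trace_form (a : 'I_n -> L) :
  ratr (\det (\matrix_(i, j) field_trace (a i * a j))) = \det (embed_mx a) ^+ 2.
Proof.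
rewrite -det_map_mx expr2 -[X in _ = _ * X]det_tr -det_mulmx; congr (\det _).
apply/matrixP => i j; rewrite !mxE /= ratr_field_trace.
by apply: eq_bigr => k _; rewrite !mxE rmorphM.
Qed.

(** Expanding the [a i] in an integral basis gives an integer matrix [M], and the right-hand side is
    [|Delta|] times the square of [\det M], a nonzero integer. *)
Lemma discriminant_le_det_embed (Delta : int) (a : 'I_n -> L) :
  field_discriminant L Delta -> (forall i, alg_integer (a i)) ->
  \det (embed_mx a) != 0 ->
  (`|Delta|%:~R : algC) <= `|\det (embed_mx a)| ^+ 2.
Proof.
case=> b [bL intb] DDelta a_int nz_a.
have /fin_all_exists[c Dc] i :
    exists ci : 'I_n -> int, a i = \sum_j (ci j)%:~R * tnth b j.
  by apply/intb.
pose M := \matrix_(i, j) c i j.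
have Da : embed_mx a = map_mx intr M *m embed_mx (tnth b).
  apply/matrixP => i k; rewrite !mxE Dc rmorph_sum.
  by apply: eq_bigr => j _; rewrite !mxE rmorphM rmorph_int.
rewrite Da det_mulmx det_map_mx in nz_a *.
have nz_M : \det M != 0 by apply: contraNneq nz_a => ->; rewrite mul0r.
rewrite normrM exprMn -[X in _ * X]normrX -ratr_det_trace_form -DDelta.
rewrite ratr_int -!intr_norm -[leLHS]mul1r ler_wpM2r ?ler0z //.
by rewrite exprn_ege1 // ler1z -gtz0_ge1 normr_gt0.
Qed.

End Embeddings.

(** * Upper bounds on the degrees of the Weil polynomial and of the field *)

Lemma size_frobenius_charpoly (F : finFieldType) (K : closedFieldType)
    (iota : {rmorphism F -> K}) (A : abelian_variety iota) l r P :
  prime l -> frobenius_charpoly A l r P -> (size P <= r.+1)%N.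
Proof.
move=> /prime_gt1 l_gt1 [e [M [_ _ _ DP]]]; apply/leq_sizeP => j le_rj.
(* For [j > r] the coefficient of [char_poly (M k)] is 0, so every [l ^ k] divides that of [P]. *)
apply: (dvd_all_powers_eq0 l_gt1) => k; have /eqP := DP k j.
by rewrite nth_default ?size_char_poly // eqz_mod_dvd sub0r rpredN.
Qed.

Lemma dim_le_degree (L : fieldExtType rat) (x : L) (h : {poly int}) :
  <<1; x>>%VS = fullv -> h != 0 -> root (map_poly (intr : int -> L) h) x ->
  (\dim {:L} <= (size h).-1)%N.
Proof.
move=> genL nz_h hx.
have Dh : map_poly (intr : int -> L) h =
    map_poly (in_alg L) (map_poly (intr : int -> rat) h).
  by rewrite -map_poly_comp; apply: eq_map_poly => z /=; rewrite scaler_int.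
have szh : size (map_poly (intr : int -> L) h) = size h.
  rewrite Dh size_map_poly size_map_inj_poly ?rmorph0 //; exact: intr_inj.
have /dvdp_leq : minPoly 1 x %| map_poly (intr : int -> L) h.
  apply: (@minPoly_dvdp _ _ 1%AS) => //; rewrite Dh.
  by apply/polyOver1P; eexists.
rewrite -size_poly_eq0 szh size_poly_eq0 size_minPoly => /(_ nz_h).
by rewrite -genL (@dim_Fadjoin _ _ 1%AS) dimv1 muln1; case: size.
Qed.

(** * The exponent of [q]: sums of distances to a centre *)

Lemma sum_centered_abs c m :
  (2 * \sum_(i < c + m) ((i - c) + (c - i)) = c * c.+1 + m * m.-1)%N.
Proof.
(* With truncated subtraction the summand is [|i - c|]. Induction on [m] adds a last term [m]; in
   the case [m = 0], induction on [c] peels off a first term [c]. *)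
elim: m => [|m IHm]; last first.
  by rewrite addnS big_ord_recr /= mulnDr IHm; case: m {IHm} => [|m]; nia.
rewrite addn0; elim: c => [|c IHc]; first by rewrite big_ord0.
rewrite big_ord_recl /= mulnDr.
under eq_bigr => i _ do rewrite /bump /= add1n !subSS.
by rewrite IHc; nia.
Qed.

Lemma sum_halfway_abs n :
  (4 * \sum_(i < n) ((i - n./2) + (n./2 - i)) <= n * n)%N.
Proof.
have Dn : (n = n./2 + (n - n./2))%N by lia.
have -> : (\sum_(i < n) ((i - n./2) + (n./2 - i)) =
  \sum_(i < n./2 + (n - n./2)) ((i - n./2) + (n./2 - i)))%N by rewrite -Dn.
have := sum_centered_abs n./2 (n - n./2).
have := odd_double_half n; case: odd => /=; nia.
Qed.

(** * Integral multiples of powers of a Weil number, and the discriminant bound *)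

Section WeilNumbers.

Variables (L : fieldExtType rat) (x : L) (q : nat).
Hypothesis q_gt0 : (0 < q)%N.
Hypothesis weil_x : weil_number q x.

Local Notation n := (\dim {:L}).
Variable s : 'I_n -> {rmorphism L -> algC}.
Hypothesis s_inj : injective (fun k => s k x).

Let k0 : 'I_n := Ordinal (adim_gt0 {:L}%AS).

Lemma weil_number_neq0 : x != 0.
Proof.
have [_ /(_ (s k0)) nx] := weil_x; apply: contraTneq q_gt0 => x0.
move: nx; rewrite x0 rmorph0 normr0 => /esym/eqP.
by rewrite sqrtC_eq0 pnatr_eq0 lt0n => ->.
Qed.

Lemma norm_embed_weil k : `|s k x| ^+ 2 = q%:R.
Proof. by case: weil_x => _ ->; rewrite sqrtCK. Qed.

Lemma norm_embed_weil_conj k : `|s k (q%:R / x)| ^+ 2 = q%:R.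
Proof.
rewrite fmorph_div rmorph_nat normf_div exprMn exprVn norm_embed_weil.
by rewrite normr_nat expr2 mulfK // pnatr_eq0 -lt0n.
Qed.

(* q / x is the complex conjugate of x, so it is a root of the same monic integer
   polynomial. *)
Lemma alg_integer_weil_conj : alg_integer (q%:R / x).
Proof.
have [[p mon_p px0] _] := weil_x; exists p => //.
have Ds : s k0 (q%:R / x) = (s k0 x)^*.
  rewrite fmorph_div rmorph_nat -(norm_embed_weil k0) normCK mulrAC mulfV ?mul1r //.
  by rewrite fmorph_eq0 weil_number_neq0.
have Dp y : root (map_poly intr p) y = root (map_poly intr p) (s k0 y).
  rewrite -(fmorph_root (s k0)) -map_poly_comp; congr (root _ _).
  by apply: eq_map_poly => z /=; rewrite rmorph_int.
rewrite Dp Ds; move: px0; rewrite Dp -(fmorph_root Num.conj) -map_poly_comp.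
by congr (root _ _); apply: eq_map_poly => z /=; rewrite rmorph_int.
Qed.

Lemma alg_integer_exp (y : L) m : alg_integer y -> alg_integer (y ^+ m).
Proof.
move=> y_int; elim: m => [|m IHm]; first exact: integral1.
by rewrite exprS; apply: integral_mul.
Qed.

(* For i < c this is q ^ (c - i) * x ^ (i - c); the factor makes it integral and
   gives its conjugates the absolute value q ^ (|i - c| / 2). *)
Definition centered_power (c i : nat) : L :=
  if (c <= i)%N then x ^+ (i - c) else (q%:R / x) ^+ (c - i).

(** Multiplying by [x ^+ c] returns to the ordinary powers of [x]; the truncated exponent [c - i]
    leaves no factor [q] once [c <= i]. *)
Lemma centered_powerE c i :
  centered_power c i * x ^+ c = q%:R ^+ (c - i) * x ^+ i.
Proof.
rewrite /centered_power; case: leqP => [le_ci | /ltnW le_ic].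
  by rewrite -exprD subnK // (eqP le_ci) mul1r.
rewrite -[in x ^+ c](subnK le_ic) exprD mulrA -exprMn divfK //.
exact: weil_number_neq0.
Qed.

Lemma alg_integer_centered_power c i : alg_integer (centered_power c i).
Proof.
rewrite /centered_power; case: ifP => _; apply: alg_integer_exp.
  by case: weil_x.
exact: alg_integer_weil_conj.
Qed.

Lemma norm_embed_centered_power c i k :
  `|s k (centered_power c i)| ^+ 2 = q%:R ^+ ((i - c) + (c - i)).
Proof.
rewrite /centered_power; case: leqP => [le_ci | /ltnW le_ic].
  by rewrite (eqP le_ci) addn0 rmorphXn normrX exprAC norm_embed_weil.
by rewrite (eqP le_ic) add0n rmorphXn normrX exprAC norm_embed_weil_conj.
Qed.

(** Scaling the columns by the conjugates of [x ^+ c] gives the Vandermonde matrix with its rows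
    scaled by powers of [q], whose determinant is nonzero. *)
Lemma det_embed_centered_power_neq0 c :
  \det (embed_mx s (fun i => centered_power c i)) != 0.
Proof.
have nz_sx k : s k x != 0 by rewrite fmorph_eq0 weil_number_neq0.
have : embed_mx s (fun i => centered_power c i) *m diag_mx (\row_k s k x ^+ c) =
  diag_mx (\row_i q%:R ^+ (c - i)) *m embed_mx s (fun i => x ^+ i).
  apply/matrixP => i k; rewrite mul_mx_diag mul_diag_mx !mxE -rmorphXn -rmorphM.
  by rewrite centered_powerE rmorphM [s k (_ ^+ (c - i))]rmorphXn rmorph_nat.
move/(congr1 determinant)/eqP; rewrite !det_mulmx !det_diag.
apply: contraTneq => ->; rewrite mul0r eq_sym mulf_neq0 ?det_embed_powers_neq0 //.
by apply/prodf_neq0 => i _; rewrite mxE expf_neq0 // pnatr_eq0 -lt0n.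
Qed.

Lemma weil_discriminant_le (Delta : int) : field_discriminant L Delta ->
  (`|Delta|%:~R : algC) <=
    n%:R ^+ n * q%:R ^+ (\sum_(i < n) ((i - n./2) + (n./2 - i))).
Proof.
move=> hDelta.
have a_int (i : 'I_n) : alg_integer (centered_power n./2 i).
  exact: alg_integer_centered_power.
apply: le_trans (discriminant_le_det_embed s_inj hDelta a_int _) _.
  exact: det_embed_centered_power_neq0.
apply: le_trans (hadamard_det _) _.
rewrite le_eqVlt; apply/orP; left; apply/eqP.
(* All [n] entries of row [i] have the same absolute value, so the inner sum is [n] equal terms. *)
transitivity (\prod_(i < n) (n%:R * q%:R ^+ ((i - n./2) + (n./2 - i)) : algC)).
  apply: eq_bigr => i _; under eq_bigr => k _ do
    rewrite mxE norm_embed_centered_power.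
  by rewrite sumr_const card_ord mulr_natl.
by rewrite big_split /= prodr_const card_ord prodrXr.
Qed.

End WeilNumbers.

Theorem theorem4p7
  (F : finFieldType) (K : closedFieldType) (iota : {rmorphism F -> K})
  (hK : algebraic_closure iota)
  (A : abelian_variety iota) (hA : av_simple A)
  (g : nat) (hg : av_dim A g)
  (l : nat) (hl : prime l) (hlq : ~~ (l %| #|F|)%N)
  (P : {poly int}) (hP : frobenius_charpoly A l (2 * g)%N P)
  (h : {poly int}) (hirr : irreducible_elt h)
  (e : nat) (he : (1 <= e)%N) (hPe : P = h ^+ e)
  (L : fieldExtType rat) (pi : L) (hL : <<1; pi>>%VS = fullv)
  (hroot : root (map_poly (intr : int -> L) h) pi)
  (hpi : weil_number #|F| pi)
  (Delta : int) (hDelta : field_discriminant L Delta) :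
  (\dim {:L}).-root (`|Delta|%:~R : algC) <= 2 * g%:R * sqrtC (#|F|%:R) ^+ g.
Proof.
have q_gt0 : (0 < #|F|)%N by apply/card_gt0P; exists 0.
set n := \dim {:L}; have n_gt0 : (0 < n)%N by exact: (adim_gt0 {:L}%AS).
have le_n_2g : (n <= 2 * g)%N.
  have [nz_h _ _] := hirr.
  apply: leq_trans (dim_le_degree hL nz_h hroot) _.
  (* As [e >= 1], the degree of [h] is at most [e] times itself, which is the degree of [P]. *)
  rewrite (leq_trans (leq_pmulr _ he)) // -size_exp -hPe.
  by have := size_frobenius_charpoly hl hP; case: (size P).
have [s s_inj] := embeddings_exist hL.
set D := (\sum_(i < n) ((i - n./2) + (n./2 - i)))%N.
(* From [4 * D <= n * n] and [n <= 2 * g]. The left side is the exponent of [sqrtC q] in [q ^ D];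
   the right side is its exponent in the [n]-th power of the target bound. *)
have le_D : (2 * D <= g * n)%N by have := sum_halfway_abs n; rewrite -/D; nia.
have sq_ge1 : 1 <= sqrtC (#|F|%:R : algC) by rewrite rootC_ge1 // ler1n.
have rhs_ge0 : 0 <= (2 * g%:R * sqrtC (#|F|%:R) ^+ g : algC).
  by rewrite -natrM mulr_ge0 ?exprn_ge0 // (le_trans ler01).
rewrite -[leRHS](exprCK n_gt0 rhs_ge0) ler_rootCl ?nnegrE ?ler0z //.
apply: le_trans (weil_discriminant_le q_gt0 hpi s_inj hDelta) _.
rewrite -/n -/D exprMn -natrM -exprM ler_pM ?exprn_ge0 //.
  by rewrite lerXn2r ?nnegrE // ler_nat.
by rewrite -{1}(sqrtCK #|F|%:R) -exprM ler_weXn2l.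
Qed.
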